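(* Let $n\ge 2$, let $C\subset\mathbb{S}^{n-1}$ be a spherical 3-distance 5-design, and let $M=|C|$ be its cardinality. Then $n$ divides $2M$.
   Context: $\mathbb{S}^{n-1}$ is the unit sphere in $\mathbb{R}^n$. A finite nonempty set $C\subset\mathbb{S}^{n-1}$ is a 3-distance code if exactly three different distances (equivalently, exactly three different inner products) occur between distinct points of $C$. $P_i^{(n)}(t)$ denotes the Gegenbauer polynomial of degree $i$ associated with $\mathbb{S}^{n-1}$, normalized by $P_i^{(n)}(1)=1$. $C$ is a spherical $\tau$-design if for every $y\in\mathbb{S}^{n-1}$ and every real polynomial $f$ of degree at most $\tau$ one has $\sum_{x\in C}f(\langle x,y\rangle)=f_0|C|$, where $f_0$ is the coefficient of $P_0^{(n)}=1$ in the Gegenbauer expansion $f(t)=\sum_i f_iP_i^{(n)}(t)$. *)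

(* Defs.v *)
From HB Require Import structures.
From mathcomp Require Import all_boot all_order all_algebra.
From mathcomp Require Import finmap reals zify.

Set Implicit Arguments.
Unset Strict Implicit.
Unset Printing Implicit Defensive.

Import Order.TTheory GRing.Theory Num.Theory.

Local Open Scope ring_scope.
Local Open Scope fset_scope.

(* The Euclidean structure of R^n; the norm that MathComp-Analysis puts on
   matrices is the sup norm and is not the one needed here. *)
Definition dotp (R : realType) (n : nat) (x y : 'rV[R]_n) : R :=
  \sum_(i < n) x 0 i * y 0 i.

Definition enorm (R : realType) (n : nat) (x : 'rV[R]_n) : R :=
  Num.sqrt (dotp x x).

Definition edist (R : realType) (n : nat) (x y : 'rV[R]_n) : R :=
  enorm (x - y).

Definition on_sphere (R : realType) (n : nat) (x : 'rV[R]_n) : Prop :=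
  enorm x = 1.

Definition spherical_code (R : realType) (n : nat) (C : {fset 'rV[R]_n}) : Prop :=
  C != fset0 /\ (forall x, x \in C -> on_sphere x).

Definition distances (R : realType) (n : nat) (C : {fset 'rV[R]_n}) : {fset R} :=
  [fset edist x y | x in C, y in C & x != y].

Lemma distancesP (R : realType) (n : nat) (C : {fset 'rV[R]_n}) (d : R) :
  reflect (exists x y, [/\ x \in C, y \in C, x != y & d = edist x y])
          (d \in distances C).
Proof.
apply: (iffP idP).
  case/imfset2P=> /= x xC [y]; rewrite !inE => /andP[yC xy] ->.
  by exists x, y.
move=> [x [y [xC yC xy ->]]]; apply/imfset2P => /=; exists x => //.
by exists y => //; rewrite !inE yC.
Qed.

Definition three_distance_code (R : realType) (n : nat) (C : {fset 'rV[R]_n}) : Prop :=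
  spherical_code C /\ #|` distances C| = 3%N.

(* P_i^(n), for n >= 2, by the three-term recurrence
     (k + n - 2) P_(k+1) = (2k + n - 2) t P_k - k P_(k-1)   for k >= 1,
   which is the Gegenbauer recurrence of parameter (n - 2) / 2 after rescaling
   to P_i(1) = 1.  For n = 2 it gives the Chebyshev polynomials of the first
   kind. *)
Fixpoint gegenbauer (R : realType) (n i : nat) : {poly R} :=
  match i with
  | 0 => 1
  | 1 => 'X
  | (j.+1 as k).+1 =>
      ((k + n - 2)%N%:R)^-1 *:
        ((2 * k + n - 2)%N%:R *: ('X * gegenbauer R n k)
         - k%:R *: gegenbauer R n j)
  end.

(* Every f of degree at most tau has exactly one expansion
   f = \sum_(i < tau.+1) c i *: P_i (gegenbauer_expansion_exists and
   gegenbauer_expansion_unique below), so c 0 is the f_0 of the definition. *)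
Definition spherical_design (R : realType) (n tau : nat) (C : {fset 'rV[R]_n}) : Prop :=
  spherical_code C /\
  forall (y : 'rV[R]_n) (f : {poly R}) (c : nat -> R),
    on_sphere y -> (size f <= tau.+1)%N ->
    f = \sum_(i < tau.+1) c i *: gegenbauer R n i ->
    \sum_(x <- C) f.[dotp x y] = c 0%N * #|` C|%:R.

Lemma gegenbauerSS (R : realType) (n j : nat) :
  gegenbauer R n j.+2 =
    ((j.+1 + n - 2)%N%:R)^-1 *:
      ((2 * j.+1 + n - 2)%N%:R *: ('X * gegenbauer R n j.+1)
       - j.+1%:R *: gegenbauer R n j).
Proof. by []. Qed.

Lemma gegenbauer1 (R : realType) (n i : nat) :
  (2 <= n)%N -> (gegenbauer R n i).[1] = 1.
Proof.
move=> n2; suff: (gegenbauer R n i).[1] = 1 /\ (gegenbauer R n i.+1).[1] = 1.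
  by case.
elim: i => [|i [IH1 IH2]]; first by rewrite /= !hornerE.
split=> //; rewrite gegenbauerSS !(hornerZ, hornerD, hornerN, hornerM, hornerX).
rewrite IH1 IH2 !mulr1 -natrB; last by lia.
have -> : (2 * i.+1 + n - 2 - i.+1)%N = (i.+1 + n - 2)%N by lia.
by rewrite mulVf // pnatr_eq0; lia.
Qed.

Lemma size_gegenbauer (R : realType) (n i : nat) :
  (2 <= n)%N -> size (gegenbauer R n i) = i.+1.
Proof.
move=> n2; suff: size (gegenbauer R n i) = i.+1 /\
                 size (gegenbauer R n i.+1) = i.+2 by case.
elim: i => [|i [IH1 IH2]]; first by rewrite /= size_poly1 size_polyX.
have nz : gegenbauer R n i.+1 != 0 by rewrite -size_poly_eq0 IH2.
split=> //; rewrite gegenbauerSS size_scale; last first.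
  by rewrite invr_eq0 pnatr_eq0; lia.
have sX : size ((2 * i.+1 + n - 2)%N%:R *: ('X * gegenbauer R n i.+1)) = i.+3.
  by rewrite size_scale ?pnatr_eq0; [rewrite mulrC size_mulX // IH2 | lia].
rewrite size_polyDl ?sX // size_polyN (leq_ltn_trans (size_scale_leq _ _)) //.
by rewrite IH1.
Qed.

Lemma gegenbauer_expansion_exists (R : realType) (n m : nat) (f : {poly R}) :
  (2 <= n)%N -> (size f <= m)%N ->
  exists c : nat -> R, f = \sum_(i < m) c i *: gegenbauer R n i.
Proof.
move=> n2; elim: m f => [|m IH] f sf.
  exists (fun=> 0); rewrite big_ord0; apply/eqP.
  by rewrite -size_poly_eq0 -leqn0.
set P := gegenbauer R n m; have sP : size P = m.+1 by exact: size_gegenbauer.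
have P0 : P`_m != 0.
  by rewrite -[m]/(m.+1.-1) -sP -lead_coefE lead_coef_eq0 -size_poly_eq0 sP.
have [|c cE] := IH (f - (f`_m / P`_m) *: P).
  apply/leq_sizeP => k; rewrite leq_eqVlt => /predU1P[<-|mk].
    by rewrite coefB coefZ divfK // subrr.
  rewrite coefB coefZ (nth_default _ (leq_trans sf mk)).
  by rewrite (@nth_default _ _ P k) ?sP // mulr0 subr0.
exists (fun i => if i == m then f`_m / P`_m else c i).
rewrite big_ord_recr /= eqxx -/P.
under eq_bigr => i _ do rewrite (ltn_eqF (ltn_ord i)).
by rewrite -cE subrK.
Qed.

Lemma gegenbauer_expansion_unique (R : realType) (n m : nat) (c d : nat -> R) :
  (2 <= n)%N ->
  \sum_(i < m) c i *: gegenbauer R n i = \sum_(i < m) d i *: gegenbauer R n i ->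
  forall i, (i < m)%N -> c i = d i.
Proof.
move=> n2; elim: m => [//|m IH]; rewrite !big_ord_recr /=.
set P := gegenbauer R n m; have sP : size P = m.+1 by exact: size_gegenbauer.
have P0 : P`_m != 0.
  by rewrite -[m]/(m.+1.-1) -sP -lead_coefE lead_coef_eq0 -size_poly_eq0 sP.
have small (e : nat -> R) : (\sum_(i < m) e i *: gegenbauer R n i)`_m = 0.
  rewrite coef_sum big1 // => i _.
  by rewrite coefZ nth_default ?mulr0 // size_gegenbauer.
move=> E; have cd : c m = d m.
  have /(congr1 (fun p : {poly R} => p`_m)) := E.
  by rewrite !coefD !coefZ !small !add0r => /(mulIf P0).
move: E; rewrite cd => /addIr /IH {}IH i.
by rewrite ltnS leq_eqVlt => /predU1P[->|/IH].
Qed.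

(* Main.v *)
Require Import Defs.
From mathcomp Require Import all_boot all_order all_algebra.
From mathcomp Require Import finmap reals.
From mathcomp Require Import zify ring lra.

Set Implicit Arguments.
Unset Strict Implicit.
Unset Printing Implicit Defensive.

Import Order.TTheory GRing.Theory Num.Theory.

Local Open Scope ring_scope.

(** Fix a point x of C, let a1, a2, a3 be the three inner products and let k_i
    be the number of points z of C with <z, x> = a_i.  The design property at
    y = x says that the nodes 1, a1, a2, a3 with the weights 1, k1, k2, k3
    integrate polynomials of degree at most 5 against the zonal measure of the
    sphere.  Three nodes besides the endpoint 1 leave so little freedom that
    the node cubic g(t) = (t - a1)(t - a2)(t - a3) = t^3 + a t^2 + b t + c has
    coefficients that are rational functions of n and M: testing g, t g and t^2 g gives
    [node_cubic_a], [node_cubic_b] and [node_cubic_c], with denominators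
    built from n + 2 and Q = 2 M - n (n + 3).

    The only arithmetic input is that the k_i are integers.  Each k_i is an
    algebraic function of n and M, but the product K = k1 k2 k3 is symmetric in
    the nodes, hence rational in n and M.  The resultant behind it factors
    completely, and [prod_weights] reads
      n^3 (n + 2) K disc(g) = M^2 (n - 1) Q.
    Clearing the denominators of disc(g) turns this into an identity between
    integers ([node_disc_form]),
      n^3 K D = (n + 2)^2 Q^5 (n - 1) M^2,
    where D is a homogeneous quartic form in n (n - 1) and Q.

    Now let d = gcd(n, 2 M) and n = n' d.  Since d divides Q and n (n - 1), the
    identity multiplied by 4 is divisible by d^7 on both sides; after the
    division, every factor on the right except (n + 2)^2 is coprime to n', so
    n'^3 divides (n + 2)^2 ([dvd_double_card]).  A prime factor of n' divides n
    and n + 2, so it is 2; but then 4 divides n and (n + 2)^2 is 4 modulo 8,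
    contradicting that 8 divides n'^3 ([no_common_part]).  Hence n' = 1 and n divides
    2 M. *)

(** * Cubic polynomials and their roots *)

Definition cubic_disc (F : fieldType) (a b c : F) : F :=
  a ^+ 2 * b ^+ 2 - 4 * b ^+ 3 - 4 * a ^+ 3 * c + 18 * a * b * c - 27 * c ^+ 2.

(** Twice the difference between M and n (n + 3) / 2, the dimension of the space
    of polynomial functions of degree at most 2 on the sphere.  Up to the factor
    n + 2 it is the common denominator of the coefficients of the node cubic. *)
Definition excess (V : comPzRingType) (n M : V) : V := 2 * M - n * (n + 3).

(** The discriminant of (n + 2) Q t^3 + (n + 2) h t^2 + C t - h, divided by its
    factor n + 2. *)
Definition disc_form (V : comPzRingType) (n h Q : V) : V :=
  let C := 2 * h - 3 * Q in
  (n + 2) * h ^+ 2 * C ^+ 2 - 4 * Q * C ^+ 3 + 4 * (n + 2) ^+ 2 * h ^+ 4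
  - 18 * (n + 2) * Q * h ^+ 2 * C - 27 * (n + 2) * Q ^+ 2 * h ^+ 2.

(** The resultant of the cubic with roots x, y, z and of t^2 - s t + p: modulo
    the quadratic the cubic reduces to X t + Y, and the right-hand side is the
    product of the values of X t + Y at the two roots of the quadratic. *)
Lemma prod_quadratic_roots (F : fieldType) (x y z s p : F) :
  let a := - (x + y + z) in
  let b := x * y + y * z + z * x in
  let c := - (x * y * z) in
  let X := s ^+ 2 - p + a * s + b in
  let Y := - (s + a) * p + c in
  (x ^+ 2 - s * x + p) * (y ^+ 2 - s * y + p) * (z ^+ 2 - s * z + p) =
  X ^+ 2 * p + X * Y * s + Y ^+ 2.
Proof. by move=> a b c X Y; rewrite /Y /X /c /b /a; ring. Qed.

Lemma cubic_discE (F : fieldType) (x y z : F) :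
  cubic_disc (- (x + y + z)) (x * y + y * z + z * x) (- (x * y * z)) =
  - (((x - y) * (x - z)) * ((y - x) * (y - z)) * ((z - x) * (z - y))).
Proof. by rewrite /cubic_disc; ring. Qed.

(** * The node cubic and the product of the weights *)

Section Quadrature.
Variables (F : fieldType) (n M x y z k1 k2 k3 : F).
Hypotheses (n0 : n != 0) (n1 : n - 1 != 0) (M0 : M != 0) (two0 : (2 : F) != 0).
(* The zonal measure has even moments 1, 1 / n, 3 / (n (n + 2)) and odd moments
   0; its total mass is scaled to M. *)
Hypothesis H0 : 1 + k1 + k2 + k3 = M.
Hypothesis H1 : 1 + k1 * x + k2 * y + k3 * z = 0.
Hypothesis H2 : n * (1 + k1 * x ^+ 2 + k2 * y ^+ 2 + k3 * z ^+ 2) = M.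
Hypothesis H3 : 1 + k1 * x ^+ 3 + k2 * y ^+ 3 + k3 * z ^+ 3 = 0.
Hypothesis H4 :
  n * (n + 2) * (1 + k1 * x ^+ 4 + k2 * y ^+ 4 + k3 * z ^+ 4) = 3 * M.
Hypothesis H5 : 1 + k1 * x ^+ 5 + k2 * y ^+ 5 + k3 * z ^+ 5 = 0.

Let a := - (x + y + z).
Let b := x * y + y * z + z * x.
Let c := - (x * y * z).

(** The quadrature applied to the node cubic g sees only the node 1, so that
    g(1) is M times the mean of g. *)
Lemma node_cubic_at1 : n * (1 + a + b + c) = M * (a + n * c).
Proof.
transitivity (n * (1 + k1 * x ^+ 3 + k2 * y ^+ 3 + k3 * z ^+ 3)
  + a * (n * (1 + k1 * x ^+ 2 + k2 * y ^+ 2 + k3 * z ^+ 2))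
  + n * b * (1 + k1 * x + k2 * y + k3 * z)
  + n * c * (1 + k1 + k2 + k3)); first by rewrite /a /b /c; ring.
by rewrite H3 H2 H1 H0; ring.
Qed.

(** The quadrature applied to t g, which has the same value at 1. *)
Lemma node_cubic_at1X :
  n * (n + 2) * (1 + a + b + c) = M * (3 + (n + 2) * b).
Proof.
transitivity (n * (n + 2) * (1 + k1 * x ^+ 4 + k2 * y ^+ 4 + k3 * z ^+ 4)
  + n * (n + 2) * a * (1 + k1 * x ^+ 3 + k2 * y ^+ 3 + k3 * z ^+ 3)
  + (n + 2) * b * (n * (1 + k1 * x ^+ 2 + k2 * y ^+ 2 + k3 * z ^+ 2))
  + n * (n + 2) * c * (1 + k1 * x + k2 * y + k3 * z)).
  by rewrite /a /b /c; ring.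
by rewrite H4 H3 H2 H1; ring.
Qed.

(** The quadrature applied to t^2 g; this is where exactness in degree 5 enters. *)
Lemma node_cubic_at1XX :
  n * (n + 2) * (1 + a + b + c) = M * (3 * a + (n + 2) * c).
Proof.
transitivity (n * (n + 2) * (1 + k1 * x ^+ 5 + k2 * y ^+ 5 + k3 * z ^+ 5)
  + a * (n * (n + 2) * (1 + k1 * x ^+ 4 + k2 * y ^+ 4 + k3 * z ^+ 4))
  + n * (n + 2) * b * (1 + k1 * x ^+ 3 + k2 * y ^+ 3 + k3 * z ^+ 3)
  + (n + 2) * c * (n * (1 + k1 * x ^+ 2 + k2 * y ^+ 2 + k3 * z ^+ 2))).
  by rewrite /a /b /c; ring.
by rewrite H5 H4 H3 H2; ring.
Qed.

Lemma node_cubic_a : a = - ((n + 2) * c).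
Proof.
apply: (mulfI n1); apply: (mulfI M0).
have e1 := node_cubic_at1; have e3 := node_cubic_at1XX.
have : (n + 2) * (M * (a + n * c)) = M * (3 * a + (n + 2) * c).
  by rewrite -e1 -e3; ring.
move/eqP; rewrite -subr_eq0 => /eqP E; apply/eqP; rewrite -subr_eq0 -E.
by apply/eqP; ring.
Qed.

Lemma node_cubic_b : (n + 2) * b = - (2 * (n + 2) * c) - 3.
Proof.
apply: (mulfI M0).
transitivity (M * (3 + (n + 2) * b) - 3 * M); first by ring.
rewrite -node_cubic_at1X.
transitivity ((n + 2) * (n * (1 + a + b + c)) - 3 * M); first by ring.
by rewrite node_cubic_at1 node_cubic_a; ring.
Qed.

(** As c = - x y z, this says 2 M / n = (1 / x - 1) (1 / y - 1) (1 / z - 1),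
    which shows how 2 M / n comes in. *)
Lemma node_cubic_1 : n * (1 + a + b + c) = - (2 * c * M).
Proof. by rewrite node_cubic_at1 {1}node_cubic_a; ring. Qed.

Lemma node_cubic_c : (n + 2) * excess n M * c = - (n * (n - 1)).
Proof.
have e : (n + 2) * (n * (1 + a + b + c)) = (n + 2) * - (2 * c * M).
  by rewrite node_cubic_1.
have : n * ((n + 2) * (1 + a + c) + (n + 2) * b) = (n + 2) * - (2 * c * M).
  by rewrite -e; ring.
rewrite node_cubic_b {1}node_cubic_a => E; rewrite /excess.
transitivity (- ((n + 2) * - (2 * c * M)) - (n + 2) * n * (n + 3) * c).
  by ring.
by rewrite -E; ring.
Qed.

(* The numerator of the weight at the node t, see weight_num. *)
Let num t := t * (1 - t) - n * c * (1 - t) + 2 * c * t.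

(** [num] is minus the quadratic t^2 - s t + p with s + a = 1 and p = n c, and
    modulo it the node cubic reduces to (n - 1) (t / (n + 2) - c); this makes
    the resultant a single term. *)
Lemma prod_num :
  (n + 2) ^+ 2 * (num x * num y * num z) = 2 * (n - 1) ^+ 2 * c.
Proof.
set s := 1 - a; set p := n * c.
have numE t : num t = - (t ^+ 2 - s * t + p).
  by rewrite /num /s /p node_cubic_a; ring.
rewrite !numE !mulrNN mulrN prod_quadratic_roots -/a -/b -/c.
have X_E : (n + 2) * (s ^+ 2 - p + a * s + b) = n - 1.
  transitivity ((n + 2) * (1 - a - n * c) + (n + 2) * b).
    by rewrite /s /p; ring.
  by rewrite node_cubic_b node_cubic_a; ring.
have Y_E : - (s + a) * p + c = - ((n - 1) * c) by rewrite /s /p; ring.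
set X := s ^+ 2 - p + a * s + b in X_E *.
rewrite Y_E.
transitivity (- (((n + 2) * X) ^+ 2 * p
  - (n + 2) * ((n + 2) * X) * (n - 1) * c * s
  + (n + 2) ^+ 2 * (n - 1) ^+ 2 * c ^+ 2)); first by ring.
by rewrite X_E /s /p node_cubic_a; ring.
Qed.

(** By Lagrange interpolation the weight k at a node t is given by a quadratic
    expression in the other nodes u and v.  Multiplying by t (1 - t) allows
    t u v and (1 - t) (1 - u) (1 - v), both known from the node cubic, to
    replace u and v. *)
Lemma weight_num (t u v k : F) :
  t * u * v = x * y * z ->
  (1 - t) * (1 - u) * (1 - v) = 1 + a + b + c ->
  n * (k * ((t - u) * (t - v))) =
    M * (1 + n * (u * v)) - n * ((1 - u) * (1 - v)) ->
  n * (k * ((t - u) * (t - v))) * (t * (1 - t)) = M * num t.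
Proof.
move=> tuv tuv1 ->.
transitivity (M * t * (1 - t) + M * n * (t * u * v) * (1 - t)
  - t * (n * ((1 - t) * (1 - u) * (1 - v)))); first by ring.
by rewrite tuv tuv1 node_cubic_1 /num /c; ring.
Qed.

(** Multiplying [weight_num] over the three nodes: the products of differences
    give - disc(g), those of t and 1 - t give - c and g(1). *)
Lemma prod_weights :
  n ^+ 3 * (n + 2) * (k1 * k2 * k3 * cubic_disc a b c) =
  M ^+ 2 * (n - 1) * excess n M.
Proof.
(* The quadrature applied to (t - u) (t - v), with u, v two of the nodes. *)
have lagr u v : M * (1 + n * (u * v)) - n * ((1 - u) * (1 - v)) =
   n * (k1 * ((x - u) * (x - v)) + k2 * ((y - u) * (y - v))
        + k3 * ((z - u) * (z - v))).
  transitivity (n * (1 + k1 * x ^+ 2 + k2 * y ^+ 2 + k3 * z ^+ 2)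
    - n * (u + v) * (1 + k1 * x + k2 * y + k3 * z)
    + n * (u * v) * (1 + k1 + k2 + k3) - n * ((1 - u) * (1 - v))).
    by rewrite H0 H1 H2; ring.
  by ring.
have ex : n * (k1 * ((x - y) * (x - z))) * (x * (1 - x)) = M * num x.
  by apply: weight_num; rewrite ?lagr /a /b /c; ring.
have ey : n * (k2 * ((y - x) * (y - z))) * (y * (1 - y)) = M * num y.
  by apply: weight_num; rewrite ?lagr /a /b /c; ring.
have ez : n * (k3 * ((z - x) * (z - y))) * (z * (1 - z)) = M * num z.
  by apply: weight_num; rewrite ?lagr /a /b /c; ring.
have c0 : c != 0.
  apply: contra_neq (mulf_neq0 n0 n1) => c0.
  by have := node_cubic_c; rewrite c0 mulr0 => /eqP; rewrite eq_sym oppr_eq0 => /eqP.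
have P : n ^+ 2 * (n + 2) ^+ 2 * (k1 * k2 * k3 * cubic_disc a b c) * c =
         - (M ^+ 2 * (n - 1) ^+ 2).
  have d0 : 2 * c * M != 0 by rewrite !mulf_neq0.
  apply: (mulIf d0).
  transitivity (- ((n + 2) ^+ 2 * (M * num x) * (M * num y) * (M * num z))).
    rewrite -ex -ey -ez cubic_discE.
    transitivity (n ^+ 2 * (n + 2) ^+ 2 *
      (k1 * k2 * k3 * cubic_disc a b c) * c * (- (n * (1 + a + b + c)))).
      by rewrite node_cubic_1 cubic_discE; ring.
    by rewrite cubic_discE /a /b /c; ring.
  transitivity (- (M ^+ 3 * ((n + 2) ^+ 2 * (num x * num y * num z)))).
    by ring.
  by rewrite prod_num; ring.
apply: (mulfI n1).
transitivity (- (n ^+ 2 * (n + 2) * (k1 * k2 * k3 * cubic_disc a b c)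
                 * - (n * (n - 1)))); first by ring.
rewrite -node_cubic_c.
transitivity (- (n ^+ 2 * (n + 2) ^+ 2 * (k1 * k2 * k3 * cubic_disc a b c) * c)
              * excess n M); first by ring.
by rewrite P; ring.
Qed.

(** Only disc(g) is not polynomial in n and M in [prod_weights]; it becomes so
    for the multiple of g by (n + 2) Q, whose discriminant is (n + 2)^4 Q^4
    disc(g). *)
Lemma node_disc_form :
  n ^+ 3 * (k1 * k2 * k3 * disc_form n (n * (n - 1)) (excess n M)) =
  (n + 2) ^+ 2 * excess n M ^+ 5 * (n - 1) * M ^+ 2.
Proof.
set h := n * (n - 1); set Q := excess n M.
have Qc : (n + 2) * Q * c = - h := node_cubic_c.
have Qb : (n + 2) * Q * b = 2 * h - 3 * Q.
  by rewrite -[h]opprK -Qc mulrAC node_cubic_b; ring.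
have D : disc_form n h Q = (n + 2) ^+ 3 * Q ^+ 4 * cubic_disc a b c.
  rewrite /disc_form -Qb -[h]opprK -Qc /cubic_disc node_cubic_a.
  by ring.
rewrite D.
transitivity ((n + 2) ^+ 2 * Q ^+ 4 *
  (n ^+ 3 * (n + 2) * (k1 * k2 * k3 * cubic_disc a b c))); first by ring.
by rewrite prod_weights -/Q; ring.
Qed.

End Quadrature.

(** * Divisibility *)

Lemma disc_formZ (d n h Q : int) :
  disc_form n (d * h) (d * Q) = d ^+ 4 * disc_form n h Q.
Proof. by rewrite /disc_form; ring. Qed.

(** A prime dividing n' divides both n' d and n' d + 2, so it is 2.  Then m is
    odd, d is even, and n' d + 2 is 2 modulo 4, too small a power of 2 for the
    cube of an even number. *)
Lemma no_common_part (n' m d M : nat) :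
  (n' * d != 0)%N -> coprime n' m -> (2 * M = m * d)%N ->
  (n' ^ 3 %| (n' * d + 2) ^ 2)%N -> n' = 1%N.
Proof.
rewrite muln_eq0 negb_or => /andP[n'0 d0] co eM dvd3.
apply/eqP/negPn/negP => n'1.
have p_pr : prime (pdiv n') by apply: pdiv_prime; lia.
set p := pdiv n' in p_pr; have pn : (p %| n')%N := pdiv_dvd n'.
have p2 : p = 2%N.
  have : (p %| (n' * d + 2) ^ 2)%N by rewrite (dvdn_trans _ dvd3) ?dvdn_exp.
  rewrite Euclid_dvdX // andbT dvdn_addr ?dvdn_mulr //.
  by rewrite dvdn_prime2 // => /eqP.
rewrite p2 in pn; have m_odd : odd m.
  rewrite -[odd m]negbK -dvdn2; apply/negP => dvd2m.
  by have : (2 %| gcdn n' m)%N; [rewrite dvdn_gcd pn | rewrite (eqP co)].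
have d2 : (2 %| d)%N.
  by rewrite -(@Gauss_dvdr 2 m d) -?eM ?dvdn_mulr // coprime2n.
(* With n' = 2 u and d = 2 v, the square is 4 modulo 8. *)
have [u eu] := dvdnP pn; have [v ev] := dvdnP d2.
have : (2 ^ 3 %| (n' * d + 2) ^ 2)%N by rewrite (dvdn_trans _ dvd3) ?dvdn_exp2r.
have -> : ((n' * d + 2) ^ 2 = 2 ^ 3 * (2 * (u * v) ^ 2 + 2 * (u * v)) + 4)%N.
  by rewrite eu ev; ring.
by apply/negP; rewrite (dvdn_addr _ (dvdn_mulr _ (dvdnn _))).
Qed.

(** Both sides are homogeneous of degree 7 in the part common to n and 2 M, so it
    cancels, and Gauss's lemma leaves the cube of n / gcd(n, 2 M) as a divisor of
    (n + 2)^2. *)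
Lemma dvd_double_card (n M : nat) (K : int) : (2 <= n)%N ->
  n%:Z ^+ 3 * (K * disc_form n%:Z (n%:Z * (n%:Z - 1)) (excess n%:Z M%:Z)) =
    (n%:Z + 2) ^+ 2 * excess n%:Z M%:Z ^+ 5 * (n%:Z - 1) * M%:Z ^+ 2 ->
  (n %| 2 * M)%N.
Proof.
move=> n_ge2; pose d := gcdn n (2 * M).
have d_gt0 : (0 < d)%N by rewrite gcdn_gt0; lia.
have [n' en] : exists n', n = (n' * d)%N by apply/dvdnP/dvdn_gcdl.
have [m eM] : exists m, (2 * M = m * d)%N by apply/dvdnP/dvdn_gcdr.
have co : coprime n' m.
  by rewrite /coprime -(eqn_pmul2r d_gt0) muln_gcdl -en -eM mul1n.
have eMZ : 2 * M%:Z = m%:Z * d%:Z by rewrite -PoszM -eM.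
have enZ : n%:Z = n'%:Z * d%:Z by rewrite -PoszM -en.
pose Q : int := m%:Z - n'%:Z * (n%:Z + 3).
have -> : excess n%:Z M%:Z = d%:Z * Q by rewrite /excess eMZ /Q enZ; ring.
have -> : n%:Z * (n%:Z - 1) = d%:Z * (n'%:Z * (n%:Z - 1)).
  by rewrite {1}enZ; ring.
rewrite disc_formZ; set D := disc_form _ _ _ => E.
have dZ0 : d%:Z ^+ 7 != 0 by rewrite expf_neq0 // eqz_nat -lt0n.
(* Powers of d on the left: 3 from n^3 and 4 from the quartic form; on the
   right: 5 from the fifth power of Q and 2 from (2 M)^2, whence the factor 4. *)
have {}E : (4 * K * D) * n'%:Z ^+ 3 =
           (n%:Z + 2) ^+ 2 * ((n%:Z - 1) * Q ^+ 5 * m%:Z ^+ 2).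
  apply: (mulfI dZ0).
  transitivity (4 * ((n'%:Z * d%:Z) ^+ 3 * (K * (d%:Z ^+ 4 * D)))).
    by ring.
  rewrite -enZ E.
  transitivity ((n%:Z + 2) ^+ 2 * (d%:Z * Q) ^+ 5 * (n%:Z - 1) * (2 * M%:Z) ^+ 2).
    by ring.
  by rewrite eMZ; ring.
have co_n'm : coprimez n'%:Z m%:Z by rewrite coprimezE.
have co_n'Q : coprimez n'%:Z Q.
  rewrite /coprimez; have -> : Q = - (n%:Z + 3) * n'%:Z + m%:Z by rewrite /Q; ring.
  by rewrite gcdzMDl.
have co_n'n : coprimez n'%:Z (n%:Z - 1).
  by rewrite /coprimez enZ mulrC gcdzMDl gcdzN gcdz1.
have dvd3 : (n'%:Z ^+ 3 %| (n%:Z + 2) ^+ 2)%Z.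
  rewrite -(@Gauss_dvdzl _ _ ((n%:Z - 1) * Q ^+ 5 * m%:Z ^+ 2)).
    by rewrite -E dvdz_mull.
  by rewrite coprimezXl // coprimezMr coprimezXr // coprimezMr co_n'n coprimezXr.
have {}dvd3 : (n' ^ 3 %| (n' * d + 2) ^ 2)%N.
  by move: dvd3; rewrite -en dvdzE !abszX.
have n'1 : n' = 1%N.
  by apply: (no_common_part _ co eM dvd3); rewrite -en; lia.
by rewrite eM en n'1 mul1n dvdn_mull.
Qed.

(** * Moments of a spherical 5-design *)

Lemma dotp_ge0 (R : realType) (n : nat) (x : 'rV[R]_n) : 0 <= dotp x x.
Proof. by apply: sumr_ge0 => i _; rewrite -expr2 sqr_ge0. Qed.

Lemma sphere_dotp (R : realType) (n : nat) (x : 'rV[R]_n) :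
  on_sphere x -> dotp x x = 1.
Proof.
move=> x1; have /sqr_sqrtr <- := dotp_ge0 x.
by rewrite -/(enorm x) x1 expr1n.
Qed.

Lemma sqr_edist (R : realType) (n : nat) (x y : 'rV[R]_n) :
  on_sphere x -> on_sphere y -> edist x y ^+ 2 = 2 - 2 * dotp x y.
Proof.
move=> /sphere_dotp x1 /sphere_dotp y1.
rewrite sqr_sqrtr ?dotp_ge0 //.
have -> : dotp (x - y) (x - y) = dotp x x + dotp y y - 2 * dotp x y.
  rewrite /dotp mulr_sumr -big_split -sumrB /=; apply: eq_bigr => i _.
  by rewrite !mxE; ring.
by rewrite x1 y1; ring.
Qed.

Lemma gegenbauer_rec (R : realType) (n k : nat) (t : R) : (2 <= n)%N ->
  (n%:R + k%:R - 1) * (gegenbauer R n k.+2).[t] =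
  (n%:R + 2 * k%:R) * (t * (gegenbauer R n k.+1).[t])
  - (k%:R + 1) * (gegenbauer R n k).[t].
Proof.
move=> n_ge2; rewrite gegenbauerSS.
rewrite !(hornerZ, hornerD, hornerN, hornerM, hornerX).
have e1 : (k.+1 + n - 2)%N%:R = n%:R + k%:R - 1 :> R.
  by rewrite natrB ?natrD; [rewrite -natr1; ring | lia].
have e2 : (2 * k.+1 + n - 2)%N%:R = n%:R + 2 * k%:R :> R.
  by rewrite natrB ?natrD ?natrM; [rewrite -natr1; ring | lia].
rewrite e1 e2 mulVKf ?natr1 //.
by rewrite -e1 pnatr_eq0; lia.
Qed.

Section Moments.
Variables (R : realType) (n : nat) (C : {fset 'rV[R]_n}) (y : 'rV[R]_n).
Hypotheses (n_ge2 : (2 <= n)%N) (C_design : spherical_design 5 C).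
Hypothesis (y1 : on_sphere y).

Local Notation P := (gegenbauer R n).
Local Notation N := (n%:R : R).

(** This is the case f = P_k of the definition of a design: the Gegenbauer
    expansion of P_k has no constant term. *)
Lemma sum_gegenbauer k : (0 < k < 6)%N -> \sum_(x <- C) (P k).[dotp x y] = 0.
Proof.
move=> /andP[k_gt0 k_lt6]; case: C_design => _ /(_ y (P k)).
move/(_ (fun i => (i == k)%:R) y1); rewrite size_gegenbauer // => /(_ k_lt6) /=.
have -> : (0 == k)%N = false by rewrite eq_sym eqn0Ngt k_gt0.
rewrite mul0r; apply.
rewrite (bigD1 (Ordinal k_lt6)) //= eqxx scale1r big1 ?addr0 // => i ik.
by rewrite (_ : (_ == _) = false) ?scale0r //; apply: negbTE.
Qed.

Lemma sum_ones : \sum_(x <- C) (1 : R) = #|` C|%:R.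
Proof. by rewrite big_const_seq count_predT iter_addr_0. Qed.

Lemma gegenbauer2E x : (N - 1) * (P 2).[x] = N * x ^+ 2 - 1.
Proof.
transitivity ((N + 0%:R - 1) * (P 2).[x]); first by ring.
by rewrite gegenbauer_rec // !hornerE; ring.
Qed.

Lemma gegenbauer3E x : (N - 1) * (P 3).[x] = (N + 2) * x ^+ 3 - 3 * x.
Proof.
have N0 : N != 0 by rewrite pnatr_eq0; lia.
apply: (mulfI N0).
transitivity ((N - 1) * ((N + 1%:R - 1) * (P 3).[x])); first by ring.
rewrite gegenbauer_rec //.
transitivity ((N + 2) * x * ((N - 1) * (P 2).[x]) - 2 * (N - 1) * (P 1).[x]).
  by ring.
by rewrite gegenbauer2E hornerX; ring.
Qed.

Lemma gegenbauer4E x : (N + 1) * (N - 1) * (P 4).[x] =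
  (N + 4) * (N + 2) * x ^+ 4 - 6 * (N + 2) * x ^+ 2 + 3.
Proof.
transitivity ((N - 1) * ((N + 2 - 1) * (P 4).[x])); first by ring.
rewrite gegenbauer_rec //.
transitivity ((N + 4) * x * ((N - 1) * (P 3).[x]) - 3 * ((N - 1) * (P 2).[x])).
  by ring.
by rewrite gegenbauer3E gegenbauer2E; ring.
Qed.

Lemma gegenbauer5E x : (N + 1) * (N - 1) * (P 5).[x] =
  (N + 6) * (N + 4) * x ^+ 5 - 10 * (N + 4) * x ^+ 3 + 15 * x.
Proof.
have N0 : N + 2 != 0 by rewrite -natrD pnatr_eq0; lia.
apply: (mulfI N0).
transitivity ((N + 1) * (N - 1) * ((N + 3 - 1) * (P 5).[x])); first by ring.
rewrite gegenbauer_rec //.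
transitivity ((N + 6) * x * ((N + 1) * (N - 1) * (P 4).[x])
              - 4 * (N + 1) * ((N - 1) * (P 3).[x])); first by ring.
by rewrite gegenbauer3E gegenbauer4E; ring.
Qed.

Local Notation s k := (\sum_(x <- C) dotp x y ^+ k).

Lemma moment1 : s 1 = 0.
Proof.
rewrite -[RHS](@sum_gegenbauer 1) //.
by apply: eq_bigr => x _; rewrite hornerX expr1.
Qed.

Lemma moment2 : N * s 2 = #|` C|%:R.
Proof.
apply: subr0_eq.
transitivity ((N - 1) * \sum_(x <- C) (P 2).[dotp x y]); last first.
  by rewrite sum_gegenbauer // mulr0.
rewrite -sum_ones !mulr_sumr -sumrB; apply: eq_bigr => x _.
by rewrite gegenbauer2E.
Qed.

Lemma moment3 : s 3 = 0.
Proof.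
have N0 : N + 2 != 0 by rewrite -natrD pnatr_eq0; lia.
apply: (mulfI N0).
transitivity ((N + 2) * s 3 - 3 * s 1); first by rewrite moment1; ring.
rewrite !mulr_sumr -sumrB mulr0.
transitivity ((N - 1) * \sum_(x <- C) (P 3).[dotp x y]); last first.
  by rewrite sum_gegenbauer // mulr0.
rewrite mulr_sumr.
by apply: eq_bigr => x _; rewrite gegenbauer3E expr1.
Qed.

Lemma moment4 : N * (N + 2) * s 4 = 3 * #|` C|%:R.
Proof.
have N0 : N + 4 != 0 by rewrite -natrD pnatr_eq0; lia.
apply: (mulfI N0).
have : (N + 4) * (N + 2) * s 4 - 6 * (N + 2) * s 2 + 3 * #|` C|%:R = 0.
  transitivity (((N + 1) * (N - 1)) * \sum_(x <- C) (P 4).[dotp x y]); last first.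
    by rewrite sum_gegenbauer // mulr0.
  rewrite -sum_ones !mulr_sumr -sumrB -big_split; apply: eq_bigr => x _.
  by rewrite gegenbauer4E mulr1.
rewrite -moment2 => E.
transitivity (N * ((N + 4) * (N + 2) * s 4 - 6 * (N + 2) * s 2 + 3 * (N * s 2))
  + (N + 4) * (3 * (N * s 2))); first by ring.
by rewrite E mulr0 add0r.
Qed.

Lemma moment5 : s 5 = 0.
Proof.
have N0 : (N + 6) * (N + 4) != 0 by rewrite -!natrD -natrM pnatr_eq0; lia.
apply: (mulfI N0).
transitivity ((N + 6) * (N + 4) * s 5 - 10 * (N + 4) * s 3 + 15 * s 1).
  by rewrite moment1 moment3; ring.
rewrite !mulr_sumr -sumrB -big_split mulr0 /=.
transitivity (((N + 1) * (N - 1)) * \sum_(x <- C) (P 5).[dotp x y]); last first.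
  by rewrite sum_gegenbauer // mulr0.
rewrite mulr_sumr.
by apply: eq_bigr => x _; rewrite gegenbauer5E expr1.
Qed.
End Moments.

(** * Counting points by their inner product *)

Lemma sum_over_values (R : pzRingType) (T V : eqType) (s : seq T) (p : pred T)
    (A : seq V) (t : T -> V) (f : V -> R) :
  uniq A -> (forall z, z \in s -> p z -> t z \in A) ->
  \sum_(z <- s | p z) f (t z) =
  \sum_(a <- A) (count (fun z => p z && (t z == a)) s)%:R * f a.
Proof.
move=> uA tA; rewrite big_seq_cond.
transitivity (\sum_(z <- s | (z \in s) && p z)
                \sum_(a <- A) (if t z == a then f a else 0)).
  apply: eq_bigr => z /andP[zs pz].
  rewrite (bigD1_seq (t z)) ?tA //= eqxx big1 ?addr0 // => a.
  by rewrite eq_sym => /negbTE->.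
rewrite -big_seq_cond exchange_big /=; apply: eq_bigr => a _.
by rewrite -big_mkcondr /= big_const_seq iter_addr_0 mulr_natl.
Qed.

(** On the sphere, <z, x> = 1 - d^2 / 2 where d is the distance from z to x, and
    this is injective in d >= 0. *)
Lemma three_inner_products (R : realType) (n : nat) (C : {fset 'rV[R]_n}) :
  three_distance_code C ->
  exists a1 a2 a3 : R, uniq [:: a1; a2; a3] /\
    forall x z, x \in C -> z \in C -> z != x -> dotp z x \in [:: a1; a2; a3].
Proof.
move=> [[_ C_sphere] card3]; pose f (d : R) := 1 - d ^+ 2 / 2.
have fE x z : x \in C -> z \in C -> dotp z x = f (edist z x).
  by move=> /C_sphere x1 /C_sphere z1; rewrite /f sqr_edist //; field.
have f_inj : {in distances C &, injective f}.
  move=> _ _ /distancesP[x [y [_ _ _ ->]]] /distancesP[z [w [_ _ _ ->]]] E.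
  have {}E : edist x y ^+ 2 = edist z w ^+ 2 by rewrite /f in E; lra.
  by apply/eqP; rewrite -(@eqrXn2 _ 2) ?sqrtr_ge0 // E.
have : uniq (map f (distances C)).
  by rewrite map_inj_in_uniq ?fset_uniq.
have : size (map f (distances C)) = 3%N by rewrite size_map.
have sub x z : x \in C -> z \in C -> z != x -> dotp z x \in map f (distances C).
  move=> xC zC zx; rewrite fE // map_f //.
  by apply/distancesP; exists z, x.
case: (map f _) sub => [|a1 [|a2 [|a3 [|? ?]]]] //= sub _ uA.
by exists a1, a2, a3.
Qed.

Theorem theorem4p1 (R : realType) (n : nat) (C : {fset 'rV[R]_n}) :
  (2 <= n)%N -> three_distance_code C -> spherical_design 5 C ->
  (n %| 2 * #|` C|)%N.
Proof.
move=> n_ge2 C3 C_design.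
have [[/fset0Pn[x xC] C_sphere] _] := C3.
have x1 := C_sphere x xC.
have [a1 [a2 [a3 [uA valA]]]] := three_inner_products C3.
pose k a := count (fun z => (z != x) && (dotp z x == a)) C.
have quad j : \sum_(z <- C) dotp z x ^+ j =
    1 + (k a1)%:R * a1 ^+ j + (k a2)%:R * a2 ^+ j + (k a3)%:R * a3 ^+ j.
  rewrite (bigD1_seq x) ?fset_uniq //= sphere_dotp // expr1n.
  rewrite (sum_over_values (fun a => a ^+ j) uA) => [|z zC zx]; last exact: valA.
  by rewrite !big_cons big_nil addr0 !addrA.
apply: (@dvd_double_card _ _ (k a1 * k a2 * k a3)%N) => //.
have n0 : n%:R != 0 :> R by rewrite pnatr_eq0; lia.
have n1 : n%:R - 1 != 0 :> R by rewrite subr_eq0 pnatr_eq1; lia.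
have M0 : #|` C|%:R != 0 :> R.
  by rewrite pnatr_eq0 cardfs_eq0; apply/fset0Pn; exists x.
apply: (@intr_inj R).
rewrite /disc_form /excess.
rewrite !(rmorph_nat, rmorphM, rmorphXn, rmorphB, rmorphD) /= -!pmulrn.
apply: (node_disc_form n0 n1 M0 (x := a1) (y := a2) (z := a3)).
- by rewrite pnatr_eq0.
- have := quad 0%N; rewrite !expr0 !mulr1 => <-; exact: sum_ones.
- have := quad 1%N; rewrite !expr1 => <-; exact: (moment1 n_ge2 C_design x1).
- by rewrite -quad; exact: (moment2 n_ge2 C_design x1).
- by rewrite -quad; exact: (moment3 n_ge2 C_design x1).
- by rewrite -quad; exact: (moment4 n_ge2 C_design x1).
- by rewrite -quad; exact: (moment5 n_ge2 C_design x1).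
Qed.
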